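(* Let $\mathcal H_1,\mathcal H_2,\mathcal D_S,\mathcal D_2,\mathcal D_{-S},\mathcal D_{-1},\mathcal D_{-2}$ be complex Hilbert spaces and $A,B,C,D_0,D,D^\ddagger$ operators satisfying assumptions (a)--(c) of the context, and let $\mathcal A_0$ (in $\mathcal H=\mathcal H_1\oplus\mathcal H_2$) and $S_0$ (in $\mathcal H_1$) be the associated maximal operator matrix and maximal Schur complement defined in the context. (i) Let $0\in\rho(D_0)$. Then $0\in\rho(\mathcal A_0)\implies 0\in\rho(S_0)$. (ii) Let $S_0\in\mathcal C(\mathcal H_1)$, let $C_0:=C|_{\operatorname{dom}C_0}$, $\operatorname{dom}C_0:=\{f\in\mathcal D_S: Cf\in\mathcal H_2\}$ (regarded as an operator from $\mathcal H_1$ to $\mathcal H_2$), and assume that either $\operatorname{coker}D_0=\{0\}$, or that $D_0\in\mathcal F_-(\mathcal H_2)$ with $\operatorname{coker}D_0\subset\operatorname{dom}C_0^*$ and $\operatorname{dom}C_0$ is dense in $\mathcal D_S$. Then $$\mathcal A_0\in\mathcal F_+(\mathcal H)\implies S_0\in\mathcal F_+(\mathcal H_1).$$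
   Context: Notation. $\mathcal B(\mathcal G_1,\mathcal G_2)$ is the space of everywhere defined bounded linear operators between Hilbert spaces; $\mathcal C(\mathcal G)$ is the set of closed (not necessarily densely defined) linear operators in $\mathcal G$; $\rho$ denotes the resolvent set. For a linear operator $T$ in $\mathcal G$, $\operatorname{coker}T:=(\operatorname{ran}T)^\perp$. $\mathcal F_+(\mathcal G)=\{T\in\mathcal C(\mathcal G):\operatorname{ran}T\text{ closed},\ \dim\ker T<\infty\}$, $\mathcal F_-(\mathcal G)=\{T\in\mathcal C(\mathcal G):\operatorname{ran}T\text{ closed},\ \dim\operatorname{coker}T<\infty\}$. For $T\in\mathcal C(\mathcal G)$ with closed range, the generalised inverse $T^\#\in\mathcal B(\mathcal G)$ is defined by $T^\#x=(T|_{\operatorname{dom}T\cap(\ker T)^\perp})^{-1}x$ for $x\in\operatorname{ran}T$ and $T^\#x=0$ for $x\in\operatorname{coker}T$. For operators, $T_1\subset T_2$ means $T_2$ extends $T_1$. Assumptions. (a) $\mathcal D_S\subset\mathcal H_1\subset\mathcal D_{-S}$ and $\mathcal D_2\subset\mathcal H_2\subset\mathcal D_{-2}$, where all these canonical embeddings are continuous with dense range; moreover $\mathcal D_{-S}\subset\mathcal D_{-1}$ is continuously embedded. (b) $A\in\mathcal B(\mathcal D_S,\mathcal D_{-1})$, $B\in\mathcal B(\mathcal D_2,\mathcal D_{-1})$, $C\in\mathcal B(\mathcal D_S,\mathcal D_{-2})$. (c) $D_0\in\mathcal C(\mathcal H_2)$ has closed range in $\mathcal H_2$, $\operatorname{dom}D_0\subset\mathcal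 D_2$ is dense in $\mathcal D_2$, and there are extensions $D_0\subset D\in\mathcal B(\mathcal D_2,\mathcal D_{-2})$ and $D_0^\#\subset D^\ddagger\in\mathcal B(\mathcal D_{-2},\mathcal D_2)$. Definitions. With $\mathcal D:=\mathcal D_S\oplus\mathcal D_2$ and $\mathcal D_-:=\mathcal D_{-1}\oplus\mathcal D_{-2}$, put $$\mathcal A:=\begin{pmatrix}A&B\\C&D\end{pmatrix}\in\mathcal B(\mathcal D,\mathcal D_-),\qquad S:=A-BD^\ddagger C\in\mathcal B(\mathcal D_S,\mathcal D_{-1}).$$ $\mathcal A_0:=\mathcal A|_{\operatorname{dom}\mathcal A_0}$ with $\operatorname{dom}\mathcal A_0:=\{(f,g)\in\mathcal D:\mathcal A(f,g)\in\mathcal H\}$, an operator in $\mathcal H=\mathcal H_1\oplus\mathcal H_2$; $S_0:=S|_{\operatorname{dom}S_0}$ with $\operatorname{dom}S_0:=\{f\in\mathcal D_S:Sf\in\mathcal H_1\}$, an operator in $\mathcal H_1$. *)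

(* Defs.v *)
From HB Require Import structures.
From mathcomp Require Import all_boot all_order all_algebra.
From mathcomp Require Import complex.
From mathcomp Require Import all_classical all_reals all_analysis.
From mathcomp Require Import ring.

Set Implicit Arguments.
Unset Strict Implicit.
Unset Printing Implicit Defensive.

Import Order.TTheory GRing.Theory Num.Theory.
Import numFieldNormedType.Exports.

Local Open Scope classical_set_scope.
Local Open Scope ring_scope.

(* The inner product is linear in its first argument and conjugate-linear in
   the second. The norm takes its values in C, as for any normedModType C. *)
HB.mixin Record CompleteNormedModule_isHilbert (C : numClosedFieldType) V
    & CompleteNormedModule C V := {
  hdot : {dot V for @Num.conj C} ;
  hdot_norm : forall x : V, hdot x x = `|x| ^+ 2
}.

#[short(type="hilbertType")]
HB.structure Definition Hilbert (C : numClosedFieldType) :=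
  {V of CompleteNormedModule C V & CompleteNormedModule_isHilbert C V}.

(* The Hilbert space direct sum. It is an alias of the product because U * V
   already carries the maximum norm, which does not come from an inner
   product. *)
Definition hsum (U V : Type) : Type := (U * V)%type.

Section DirectSum.
Variables (C : numClosedFieldType) (U V : hilbertType C).

HB.instance Definition _ := GRing.Lmodule.copy (hsum U V) (U * V)%type.

Implicit Types x y : hsum U V.

Let hnorm x : C := sqrtC (`|x.1| ^+ 2 + `|x.2| ^+ 2).

Let hnorm_ge0 x : 0 <= hnorm x.
Proof. by rewrite sqrtC_ge0 addr_ge0// exprn_ge0. Qed.

Let sqr_hnorm x : hnorm x ^+ 2 = `|x.1| ^+ 2 + `|x.2| ^+ 2.
Proof. by rewrite sqrtCK. Qed.

Let hnormD x y : hnorm (x + y) <= hnorm x + hnorm y.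
Proof.
rewrite -ler_sqr ?nnegrE ?addr_ge0// sqr_hnorm sqrrD !sqr_hnorm.
set a := `|x.1|; set b := `|x.2|; set c := `|y.1|; set d := `|y.2|.
have [a0 b0 c0 d0] : [/\ 0 <= a, 0 <= b, 0 <= c & 0 <= d].
  by split; exact: normr_ge0.
have le1 : `|(x + y).1| ^+ 2 + `|(x + y).2| ^+ 2 <= (a + c) ^+ 2 + (b + d) ^+ 2.
  have h1 : `|(x + y).1| <= a + c := ler_normD x.1 y.1.
  have h2 : `|(x + y).2| <= b + d := ler_normD x.2 y.2.
  by apply: lerD; apply: lerXn2r; rewrite ?nnegrE ?addr_ge0.
apply: (le_trans le1).
have cs : a * c + b * d <= hnorm x * hnorm y.
  rewrite -ler_sqr ?nnegrE ?addr_ge0 ?mulr_ge0// exprMn !sqr_hnorm -subr_ge0.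
  rewrite -/a -/b -/c -/d.
  have -> : (a ^+ 2 + b ^+ 2) * (c ^+ 2 + d ^+ 2) - (a * c + b * d) ^+ 2 =
            (a * d - b * c) ^+ 2 by ring.
  by rewrite real_exprn_even_ge0// rpredB// rpredM// normr_real.
have -> : (a + c) ^+ 2 + (b + d) ^+ 2 =
  a ^+ 2 + b ^+ 2 + (a * c + b * d) *+ 2 + (c ^+ 2 + d ^+ 2) by ring.
by rewrite lerD2r lerD2l lerMn2r.
Qed.

Let hnormZ (l : C) x : hnorm (l *: x) = `|l| * hnorm x.
Proof.
apply/eqP; rewrite -(@eqrXn2 _ 2) ?mulr_ge0// exprMn !sqr_hnorm !normrZ.
by rewrite !exprMn mulrDr.
Qed.

Let hnorm0_eq0 x : hnorm x = 0 -> x = 0.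
Proof.
move/eqP; rewrite sqrtC_eq0 paddr_eq0 ?exprn_ge0// !sqrf_eq0 !normr_eq0.
by case: x => x1 x2 /= /andP[/eqP-> /eqP->].
Qed.

HB.instance Definition _ :=
  Lmodule_isNormed.Build C (hsum U V) hnormD hnormZ hnorm0_eq0.

Lemma hsum_normE x : `|x| = sqrtC (`|x.1| ^+ 2 + `|x.2| ^+ 2).
Proof. by []. Qed.

Lemma hsum_sqr_norm x : `|x| ^+ 2 = `|x.1| ^+ 2 + `|x.2| ^+ 2.
Proof. exact: sqr_hnorm. Qed.

Lemma hsum_norm1 x : `|x.1| <= `|x|.
Proof. by rewrite -ler_sqr ?nnegrE// hsum_sqr_norm lerDl exprn_ge0. Qed.

Lemma hsum_norm2 x : `|x.2| <= `|x|.
Proof. by rewrite -ler_sqr ?nnegrE// hsum_sqr_norm lerDr exprn_ge0. Qed.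

Lemma hsum_norm_le x : `|x| <= `|x.1| + `|x.2|.
Proof.
rewrite -ler_sqr ?nnegrE ?addr_ge0// hsum_sqr_norm sqrrD addrAC lerDl.
by rewrite mulrn_wge0// mulr_ge0.
Qed.

Let hsum_complete (F : set_system (hsum U V)) :
  ProperFilter F -> cauchy F -> cvg F.
Proof.
move=> FF /cauchy_ballP cF.
have c1 : cvg ((fun x : hsum U V => x.1) @ F).
  apply: cauchy_cvg; apply/cauchy_ballP => e e0.
  have := cF e e0; rewrite !near_simpl => -[[A B] [/= FA FB] AB].
  exists ([set x.1 | x in A], [set x.1 | x in B]).
    by split=> /=; [apply: filterS FA|apply: filterS FB] => x ? /=; exists x.
  move=> [_ _] [/= [x Ax <-] [y By <-]]; have := AB (x, y) (conj Ax By).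
  rewrite /= -!ball_normE /ball_/=.
  exact: le_lt_trans (hsum_norm1 (x - y)).
have c2 : cvg ((fun x : hsum U V => x.2) @ F).
  apply: cauchy_cvg; apply/cauchy_ballP => e e0.
  have := cF e e0; rewrite !near_simpl => -[[A B] [/= FA FB] AB].
  exists ([set x.2 | x in A], [set x.2 | x in B]).
    by split=> /=; [apply: filterS FA|apply: filterS FB] => x ? /=; exists x.
  move=> [_ _] [/= [x Ax <-] [y By <-]]; have := AB (x, y) (conj Ax By).
  rewrite /= -!ball_normE /ball_/=.
  exact: le_lt_trans (hsum_norm2 (x - y)).
move: c1 c2 => /cvg_ex[l1 c1] /cvg_ex[l2 c2].
apply/cvg_ex; exists ((l1, l2) : hsum U V).
apply/cvgrPdist_lt => e e0; near=> x.
apply: (le_lt_trans (hsum_norm_le _)); rewrite /= (splitr e) ltrD//.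
- by near: x; move/cvgrPdist_lt : c1; apply; rewrite divr_gt0.
- by near: x; move/cvgrPdist_lt : c2; apply; rewrite divr_gt0.
Unshelve. all: by end_near. Qed.

HB.instance Definition _ := Uniform_isComplete.Build (hsum U V) hsum_complete.

Definition hsum_dot x y : C := hdot x.1 y.1 + hdot x.2 y.2.

Let hsum_dot_bilinear : bilinear_for
  (GRing.Scale.Law.clone _ _ ( *%R ) _)
  (GRing.Scale.Law.clone _ _ (@Num.conj C \; *%R) _) hsum_dot.
Proof.
split=> [y a u v|x a u v]; rewrite /hsum_dot /=.
- by rewrite !linearDl !linearZl_LR /=; ring.
- by rewrite !linearDr !linearZr_LR /=; ring.
Qed.

HB.instance Definition _ := bilinear_isBilinear.Build C (hsum U V) (hsum U V) C
  *%R (@Num.conj C \; *%R) hsum_dot hsum_dot_bilinear.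

Let hsum_dot_herm x y : hsum_dot x y = (-1) ^+ false * (hsum_dot y x)^*.
Proof.
rewrite mul1r rmorphD /hsum_dot; congr (_ + _).
  by rewrite hermC mul1r.
by rewrite hermC mul1r.
Qed.

HB.instance Definition _ :=
  isHermitianSesquilinear.Build C (hsum U V) false (@Num.conj C) hsum_dot
    hsum_dot_herm.

Let hsum_dotxx x : hsum_dot x x = `|x| ^+ 2.
Proof. by rewrite hsum_sqr_norm /hsum_dot !hdot_norm. Qed.

Let hsum_dot_gt0 x : x != 0 -> 0 < hsum_dot x x.
Proof. by move=> x0; rewrite hsum_dotxx exprn_gt0// normr_gt0. Qed.

HB.instance Definition _ := isDotProduct.Build C (hsum U V) hsum_dot hsum_dot_gt0.

HB.instance Definition _ :=
  @CompleteNormedModule_isHilbert.Build C (hsum U V) hsum_dot hsum_dotxx.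

Lemma hsum_dotE x y : hdot x y = hdot x.1 y.1 + hdot x.2 y.2.
Proof. by []. Qed.

End DirectSum.

Section BoundedOperators.
Variable C : numClosedFieldType.
Implicit Types U V W X Y : hilbertType C.

Record bounded_op U V := BoundedOp {
  bop :> {linear U -> V} ;
  bop_bounded : exists M : C, forall x : U, `|bop x| <= M * `|x|
}.

Lemma bop_bound_ge0 U V (f : bounded_op U V) :
  exists2 M : C, 0 <= M & forall x : U, `|f x| <= M * `|x|.
Proof.
have [M Mf] := bop_bounded f; exists `|M| => // x.
have := Mf x; have Mx0 : 0 <= M * `|x| by exact: le_trans (Mf x).
by rewrite -[X in _ <= X -> _](ger0_norm Mx0) normrM normr_id.
Qed.

Record embedding U V := Embedding {
  emb :> bounded_op U V ;
  emb_inj : injective emb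
}.

Section Comp.
Variables (U V W : hilbertType C) (g : embedding V W) (f : embedding U V).

Let comp_bounded : exists M : C, forall x : U, `|(g \o f) x| <= M * `|x|.
Proof.
have [Mf Mf0 fb] := bop_bound_ge0 f; have [Mg Mg0 gb] := bop_bound_ge0 g.
exists (Mg * Mf) => x /=; apply: (le_trans (gb _)).
by rewrite -mulrA ler_wpM2l.
Qed.

Let comp_inj : injective (BoundedOp comp_bounded).
Proof. exact: inj_comp (@emb_inj _ _ g) (@emb_inj _ _ f). Qed.

Definition emb_comp : embedding U W := Embedding comp_inj.

Lemma emb_compE x : emb_comp x = g (f x).
Proof. by []. Qed.
End Comp.

Section Sum.
Variables (U1 U2 V1 V2 : hilbertType C).
Variables (f1 : embedding U1 V1) (f2 : embedding U2 V2).

Definition sum_fun (x : hsum U1 U2) : hsum V1 V2 := (f1 x.1, f2 x.2).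

Let sum_fun_linear : linear sum_fun.
Proof. by move=> a x y; rewrite /sum_fun /= !linearP. Qed.

HB.instance Definition _ := GRing.isLinear.Build C (hsum U1 U2) (hsum V1 V2) _
  sum_fun sum_fun_linear.

Let sum_fun_bounded : exists M : C, forall x, `|sum_fun x| <= M * `|x|.
Proof.
have [M1 M10 b1] := bop_bound_ge0 f1; have [M2 M20 b2] := bop_bound_ge0 f2.
exists (M1 + M2) => x; apply: (le_trans (hsum_norm_le _)); rewrite /= mulrDl.
apply: lerD.
  by apply: (le_trans (b1 _)); apply: ler_wpM2l => //; exact: hsum_norm1.
by apply: (le_trans (b2 _)); apply: ler_wpM2l => //; exact: hsum_norm2.
Qed.

Let sum_fun_inj : injective (BoundedOp sum_fun_bounded).
Proof. by move=> [x1 x2] [y1 y2] /= [/emb_inj-> /emb_inj->]. Qed.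

Definition emb_sum : embedding (hsum U1 U2) (hsum V1 V2) :=
  Embedding sum_fun_inj.

Lemma emb_sumE x : emb_sum x = (f1 x.1, f2 x.2).
Proof. by []. Qed.
End Sum.

Section Block.
Variables (U1 U2 V1 V2 : hilbertType C).
Variables (f11 : bounded_op U1 V1) (f12 : bounded_op U2 V1).
Variables (f21 : bounded_op U1 V2) (f22 : bounded_op U2 V2).

Definition block_fun (x : hsum U1 U2) : hsum V1 V2 :=
  (f11 x.1 + f12 x.2, f21 x.1 + f22 x.2).

Let block_fun_linear : linear block_fun.
Proof.
move=> a x y; rewrite /block_fun /= !linearP.
by congr (_, _); rewrite /= scalerDr addrACA.
Qed.

HB.instance Definition _ := GRing.isLinear.Build C (hsum U1 U2) (hsum V1 V2) _
  block_fun block_fun_linear.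

Let block_fun_bounded : exists M : C, forall x, `|block_fun x| <= M * `|x|.
Proof.
have [M11 M110 b11] := bop_bound_ge0 f11.
have [M12 M120 b12] := bop_bound_ge0 f12.
have [M21 M210 b21] := bop_bound_ge0 f21.
have [M22 M220 b22] := bop_bound_ge0 f22.
exists ((M11 + M12) + (M21 + M22)) => x; apply: (le_trans (hsum_norm_le _)).
have n1 := hsum_norm1 x; have n2 := hsum_norm2 x.
rewrite /= !mulrDl; apply: lerD; apply: (le_trans (ler_normD _ _)).
  apply: lerD; [apply: (le_trans (b11 _))|apply: (le_trans (b12 _))];
  exact: ler_wpM2l.
apply: lerD; [apply: (le_trans (b21 _))|apply: (le_trans (b22 _))];
exact: ler_wpM2l.
Qed.

Definition block_op : bounded_op (hsum U1 U2) (hsum V1 V2) :=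
  BoundedOp block_fun_bounded.

Lemma block_opE x : block_op x = (f11 x.1 + f12 x.2, f21 x.1 + f22 x.2).
Proof. by []. Qed.
End Block.

Section Schur.
Variables (U1 U2 V1 V2 : hilbertType C).
Variables (A : bounded_op U1 V1) (B : bounded_op U2 V1).
Variables (F : bounded_op U1 V2) (Dd : bounded_op V2 U2).

Let schur_bounded :
  exists M : C, forall x, `|(A \- (B \o Dd \o F)) x| <= M * `|x|.
Proof.
have [MA MA0 bA] := bop_bound_ge0 A; have [MB MB0 bB] := bop_bound_ge0 B.
have [MF MF0 bF] := bop_bound_ge0 F; have [MD MD0 bD] := bop_bound_ge0 Dd.
exists (MA + MB * (MD * MF)) => x; apply: (le_trans (ler_normB _ _)).
rewrite mulrDl; apply: lerD => //=.
rewrite -!mulrA; apply: (le_trans (bB _)); apply: ler_wpM2l => //.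
by apply: (le_trans (bD _)); apply: ler_wpM2l.
Qed.

Definition schur_complement : bounded_op U1 V1 := BoundedOp schur_bounded.

Lemma schur_complementE x : schur_complement x = A x - B (Dd (F x)).
Proof. by []. Qed.
End Schur.

End BoundedOperators.

Section Operators.
Variable C : numClosedFieldType.
Implicit Types U V W X Y : hilbertType C.

(* A linear operator defined on a subspace of U, given by its graph. *)
Record operator U V := Operator {
  op_graph : set (U * V) ;
  op_graph0 : op_graph 0 ;
  op_graph_linear : forall (a : C) p q,
    op_graph p -> op_graph q -> op_graph (a *: p + q) ;
  op_graph_functional : forall x y y',
    op_graph (x, y) -> op_graph (x, y') -> y = y'
}.

Definition dom U V (T : operator U V) : set U :=
  [set x | exists y, op_graph T (x, y)].

Definition ran U V (T : operator U V) : set V :=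
  [set y | exists x, op_graph T (x, y)].

Definition ker U V (T : operator U V) : set U := [set x | op_graph T (x, 0)].

Definition orthogonal_complement U (E : set U) : set U :=
  [set y | forall x, E x -> hdot x y = 0].

Definition coker U V (T : operator U V) : set V :=
  orthogonal_complement (ran T).

Definition closed_operator U V (T : operator U V) : Prop :=
  closed (op_graph T).

Definition finite_dimensional U (E : set U) : Prop :=
  exists n (b : 'I_n -> U),
    E = [set x | exists c : 'I_n -> C, x = \sum_(i < n) c i *: b i].

Definition semiFredholm_plus U (T : operator U U) : Prop :=
  [/\ closed_operator T, closed (ran T) & finite_dimensional (ker T)].

Definition semiFredholm_minus U (T : operator U U) : Prop :=
  [/\ closed_operator T, closed (ran T) & finite_dimensional (coker T)].

(* The domain of the adjoint of T. The vector z, which is T^* y, is unique as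
   soon as T is densely defined. *)
Definition dom_adjoint U V (T : operator U V) : set V :=
  [set y | exists z, forall x w, op_graph T (x, w) -> hdot w y = hdot x z].

Section Shift.
Variables (U : hilbertType C) (T : operator U U) (l : C).

Let shift_graph : set (U * U) :=
  [set p | exists2 y, op_graph T (p.1, y) & p.2 = y - l *: p.1].

Let shift_graph0 : shift_graph 0.
Proof.
by exists 0; [exact: (op_graph0 T)|rewrite /= scaler0 subr0].
Qed.

Let shift_graph_linear (a : C) p q :
  shift_graph p -> shift_graph q -> shift_graph (a *: p + q).
Proof.
move=> [y Ty py] [z Tz qz]; exists (a *: y + z).
  exact: (op_graph_linear a Ty Tz).
rewrite /= py qz scalerBr scalerDr opprD !scalerA [l * a]mulrC.
by rewrite addrACA.
Qed.

Let shift_graph_functional x y y' :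
  shift_graph (x, y) -> shift_graph (x, y') -> y = y'.
Proof.
move=> [z /= Tz ->] [z' /= Tz' ->]; congr (_ - _).
exact: op_graph_functional Tz Tz'.
Qed.

Definition op_shift : operator U U :=
  Operator shift_graph0 shift_graph_linear shift_graph_functional.
End Shift.

Lemma op_shiftE U (T : operator U U) l x y :
  op_graph (op_shift T l) (x, y) <-> op_graph T (x, y + l *: x).
Proof.
split=> [[z /= Tz ->]|Txy]; first by rewrite subrK.
by exists (y + l *: x); rewrite //= addrK.
Qed.

(* The condition says that T - l maps dom T bijectively onto U, with an inverse
   R that is bounded and everywhere defined. *)
Definition resolvent_set U (T : operator U U) : set C :=
  [set l | exists R : bounded_op U U,
    forall x y, op_graph (op_shift T l) (x, y) <-> x = R y].

Section GeneralisedInverse.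
Variables (U : hilbertType C) (T : operator U U).

(* T^# maps x + z, with x in ran T and z in coker T, to the preimage of x in
   the orthogonal complement of ker T. *)
Let ginv_graph : set (U * U) :=
  [set p | exists x z, [/\ p.1 = x + z, coker T z, op_graph T (p.2, x) &
                           orthogonal_complement (ker T) p.2]].

Let ginv_graph0 : ginv_graph 0.
Proof.
exists 0, 0; split; rewrite ?addr0//; last first.
- by move=> x _; rewrite linear0r.
- exact: (op_graph0 T).
- by move=> x _; rewrite linear0r.
Qed.

Let ginv_graph_linear (a : C) p q :
  ginv_graph p -> ginv_graph q -> ginv_graph (a *: p + q).
Proof.
move=> [x [z [pxz cz Tx kp]]] [x' [z' [qxz cz' Tx' kq]]].
exists (a *: x + x'), (a *: z + z'); split.
- by rewrite /= pxz qxz scalerDr addrACA.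
- by move=> w rw; rewrite linearDr linearZr_LR /= cz// cz'// mulr0 addr0.
- exact: (op_graph_linear a Tx Tx').
- by move=> w rw; rewrite /= linearDr linearZr_LR /= kp// kq// mulr0 addr0.
Qed.

Let hdot0 (x : U) : hdot x x = 0 -> x = 0.
Proof.
by move/eqP; rewrite hdot_norm sqrf_eq0 normr_eq0 => /eqP.
Qed.

Let graphB (x y x' y' : U) : op_graph T (x, y) -> op_graph T (x', y') ->
  op_graph T (x - x', y - y').
Proof.
move=> Txy Txy'; have := op_graph_linear (-1) Txy' Txy.
by rewrite (_ : _ + _ = (x - x', y - y'))//; congr (_, _);
  rewrite /= scaleN1r addrC.
Qed.

Let ginv_graph_functional x y y' :
  ginv_graph (x, y) -> ginv_graph (x, y') -> y = y'.
Proof.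
move=> [a [b [/= -> cb Ta ky]]] [a' [b' [/= ab cb' Ta' ky']]].
have TB := graphB Ta Ta'.
have aE : a - a' = b' - b.
  by apply/eqP; rewrite subr_eq addrAC eq_sym subr_eq addrC -ab addrC.
have a0 : a - a' = 0.
  apply: hdot0; rewrite {2}aE linearBr /= cb'; last by exists (y - y').
  by rewrite cb ?subr0//; exists (y - y').
rewrite a0 in TB; apply/eqP; rewrite -subr_eq0; apply/eqP/hdot0.
by rewrite linearBr /= ky// ky'// subr0.
Qed.

Definition generalised_inverse : operator U U :=
  Operator ginv_graph0 ginv_graph_linear ginv_graph_functional.

Lemma generalised_inverseE x y : op_graph generalised_inverse (x, y) <->
  exists a z, [/\ x = a + z, coker T z, op_graph T (y, a) &
                  orthogonal_complement (ker T) y].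
Proof. by []. Qed.
End GeneralisedInverse.

Section Maximal.
Variables (X U V Y : hilbertType C).
Variables (i : embedding X U) (j : embedding V Y) (E : bounded_op X Y).

Let max_graph : set (U * V) := [set p | exists2 u, p.1 = i u & E u = j p.2].

Let max_graph0 : max_graph 0.
Proof. by exists 0; rewrite /= !linear0. Qed.

Let max_graph_linear (a : C) p q :
  max_graph p -> max_graph q -> max_graph (a *: p + q).
Proof.
move=> [u pu Eu] [v qv Ev]; exists (a *: u + v); rewrite /= !linearP.
  by rewrite pu qv.
by rewrite Eu Ev.
Qed.

Let max_graph_functional x y y' :
  max_graph (x, y) -> max_graph (x, y') -> y = y'.
Proof.
move=> [u /= -> Eu] [v /= /emb_inj <-]; rewrite Eu.
exact: emb_inj.
Qed.

(* The restriction of E to the u in X with E u in V, as an operator from U to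
   V, where X is embedded in U and V is embedded in Y. *)
Definition maximal_operator : operator U V :=
  Operator max_graph0 max_graph_linear max_graph_functional.

Lemma maximal_operatorE x y :
  op_graph maximal_operator (x, y) <-> exists2 u, x = i u & E u = j y.
Proof. by []. Qed.
End Maximal.

End Operators.

(* Main.v *)
(* Let q = 1 - D D^ddagger. For every u in D_S, the block operator sends
   (u, -D^ddagger C u) to (S u, q C u). Since D_0 has closed range, q maps the
   dense subspace H_2 onto coker D_0. If this is finite-dimensional, hence
   closed, then q maps all of D_{-2} into it.

   (i) Here D and D^ddagger are inverse to each other, so q = 0, and the first
   component of A_0^{-1}(h, 0) inverts S_0.

   (ii) Up to finitely many dimensions one may assume q C u = 0, so that the
   kernel of S_0 embeds in that of A_0. Let L be the restriction of A_0 to the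
   pairs (x, (h, 0)) with S_0 x_1 = h. It is closed because S_0 is, and a closed
   restriction of an operator in F_+ has closed range: with T^# bounded, y is in
   ran L if and only if (T^# y, y) is in the closed subspace L + ker T x 0. The
   range of S_0 is the range of L plus a finite-dimensional space. *)

Require Import Defs.
From HB Require Import structures.
From mathcomp Require Import all_boot all_order all_algebra.
From mathcomp Require Import complex.
From mathcomp Require Import all_classical all_reals all_analysis.
From mathcomp Require Import ring lra.

Set Implicit Arguments.
Unset Strict Implicit.
Unset Printing Implicit Defensive.

Import Order.TTheory GRing.Theory Num.Theory.
Import numFieldNormedType.Exports.

Local Open Scope classical_set_scope.
Local Open Scope ring_scope.
Local Open Scope complex_scope.

(** * Real-valued norms and epsilon forms of the topology *)

Section RealNorm.
Variable R : realType.

(* The norms of the spaces below are complex numbers; [nrm] is the same norm as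
   a real number, so that the order is total and suprema exist. *)
Definition nrm (V : normedZmodType R[i]) (x : V) : R := complex.Re `|x|.

Implicit Types V W : normedModType R[i].

Lemma nrmE V (x : V) : `|x| = (nrm x)%:C.
Proof. by rewrite /nrm RRe_real// normr_real. Qed.

Lemma nrm_ge0 V (x : V) : 0 <= nrm x.
Proof. by rewrite -lecR -nrmE normr_ge0. Qed.

Lemma nrmD V (x y : V) : nrm (x + y) <= nrm x + nrm y.
Proof. by rewrite -lecR rmorphD /= -!nrmE ler_normD. Qed.

Lemma nrmN V (x : V) : nrm (- x) = nrm x.
Proof. by rewrite /nrm normrN. Qed.

Lemma nrm_distC V (x y : V) : nrm (x - y) = nrm (y - x).
Proof. by rewrite -opprB nrmN. Qed.

Lemma nrm_triangle V (z x y : V) : nrm (x - y) <= nrm (x - z) + nrm (z - y).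
Proof. by apply: le_trans (nrmD _ _); rewrite addrA subrK. Qed.

Lemma nrmZ V (a : R[i]) (x : V) : nrm (a *: x) = nrm (a : R[i]^o) * nrm x.
Proof. by apply: complexI; rewrite rmorphM /= -!nrmE normrZ. Qed.

Lemma nrm_real (a : R) : nrm (a%:C : R[i]^o) = `|a|.
Proof. by rewrite /nrm normc_def /= expr0n /= addr0 sqrtr_sqr. Qed.

Lemma nrmZr V (a : R) (x : V) : nrm (a%:C *: x) = `|a| * nrm x.
Proof. by rewrite nrmZ nrm_real. Qed.

Lemma nrm0 V : nrm (0 : V) = 0.
Proof. by rewrite /nrm normr0. Qed.

Lemma nrm_eq0 V (x : V) : nrm x = 0 -> x = 0.
Proof. by move=> x0; apply/eqP; rewrite -normr_eq0 nrmE x0. Qed.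

Lemma nrm_lt_eps V (x : V) : (forall e : R, 0 < e -> nrm x < e) -> x = 0.
Proof.
move=> xe; apply/nrm_eq0/eqP; rewrite eq_le nrm_ge0 andbT leNgt.
by apply/negP => /xe; rewrite ltxx.
Qed.

(** A positive element of [R[i]] is real, so balls of complex radius are the balls of real
    radius. *)
Lemma nbhs_nrmP V (x : V) (P : set V) :
  nbhs x P <-> exists2 e : R, 0 < e & forall z, nrm (x - z) < e -> P z.
Proof.
split=> [/nbhs_normP[e /= e0 eP]|[e e0 eP]].
  have eE : (complex.Re e)%:C = e by rewrite RRe_real// gtr0_real.
  exists (complex.Re e) => [|z ez]; first by rewrite -ltcR eE.
  by apply: eP; rewrite /= nrmE -eE ltcR.
apply/nbhs_normP; exists e%:C; first by rewrite /= ltcR.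
by move=> z /=; rewrite nrmE ltcR; exact: eP.
Qed.

Lemma closed_nrmP V (E : set V) : closed E <->
  forall x, (forall e : R, 0 < e -> exists2 z, E z & nrm (x - z) < e) -> E x.
Proof.
split=> [cE x xE|EP x xE].
  apply: cE => B /nbhs_nrmP[e e0 eB].
  by have [z Ez xz] := xE e e0; exists z; split=> //; exact: eB.
apply: EP => e e0; have [|z [Ez /= xz]] := xE [set z | nrm (x - z) < e].
  by apply/nbhs_nrmP; exists e.
by exists z.
Qed.

Lemma dense_nrmP V (E : set V) : dense E ->
  forall x (e : R), 0 < e -> exists2 z, E z & nrm (x - z) < e.
Proof.
move=> dE x e e0; have : nbhs x [set z | nrm (x - z) < e].
  by apply/nbhs_nrmP; exists e.
rewrite nbhsE => -[A [oA Ax] Ae].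
by have [|z [/Ae xz Ez]] := dE A _ oA; [exists x | exists z].
Qed.

(** [V * W] carries the maximum norm, so a pair is small exactly when both of its components are. *)
Lemma closed_pairP V W (E : set (V * W)) : closed E <->
  forall x y, (forall e : R, 0 < e -> exists p,
    [/\ E p, nrm (x - p.1) < e & nrm (y - p.2) < e]) -> E (x, y).
Proof.
rewrite closed_nrmP; have nE (p : V * W) (e : R) :
    (nrm p < e) = (nrm p.1 < e) && (nrm p.2 < e).
  by rewrite -!ltcR -!nrmE prod_normE comparable_gt_max// real_comparable.
split=> [EP x y xyE|EP [x y] xyE]; apply: EP => e /xyE.
  by move=> [p [Ep xp yp]]; exists p => //; rewrite nE xp.
by move=> [p Ep]; rewrite nE => /andP[xp yp]; exists p.
Qed.

Lemma cauchy_nrm_cvg (V : completeNormedModType R[i]) (u : nat -> V) :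
  (forall e : R, 0 < e -> exists N, forall m n, (N <= m)%N -> (N <= n)%N ->
    nrm (u m - u n) < e) ->
  exists l, forall e : R, 0 < e -> exists N, forall n, (N <= n)%N ->
    nrm (u n - l) < e.
Proof.
move=> uC; have cu : cauchy_ex (u @ \oo).
  move=> e e0; have eE : (complex.Re e)%:C = e by rewrite RRe_real// gtr0_real.
  have [|N uN] := uC (complex.Re e); first by rewrite -ltcR eE.
  exists (u N); exists N => // n Nn /=.
  by rewrite -ball_normE /= nrmE -eE ltcR uN.
have /cvg_ex[l ul] : cvg (u @ \oo) by apply: cauchy_cvg; exact: cauchy_exP.
exists l => e e0; have : nbhs l [set z | nrm (l - z) < e].
  by apply/nbhs_nrmP; exists e.
by move=> /ul[N _ uN]; exists N => n /uN; rewrite /= nrm_distC.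
Qed.

End RealNorm.

(** * Orthogonal projections *)

Definition submodule (K : pzRingType) (V : lmodType K) (M : set V) :=
  M 0 /\ forall (a : K) x y, M x -> M y -> M (a *: x + y).

Section Subspace.
Variables (K : pzRingType) (V : lmodType K) (M : set V).
Hypothesis sM : submodule M.

Lemma submodule0 : M 0. Proof. by case: sM. Qed.

Lemma submoduleP a x y : M x -> M y -> M (a *: x + y).
Proof. by case: sM => _; exact. Qed.

Lemma submoduleD x y : M x -> M y -> M (x + y).
Proof. by move=> Mx My; rewrite -[x]scale1r; exact: submoduleP. Qed.

Lemma submoduleZ a x : M x -> M (a *: x).
Proof.
move=> Mx; rewrite -[_ *: _]addr0; apply: submoduleP => //; exact: submodule0.
Qed.

Lemma submoduleB x y : M x -> M y -> M (x - y).
Proof. by move=> Mx My; rewrite addrC -scaleN1r; exact: submoduleP. Qed.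
End Subspace.

Section InnerProduct.
Variables (R : realType) (U : hilbertType R[i]).
Implicit Types (x y z : U) (M : set U).

Lemma hdotC x y : hdot x y = Num.conj (hdot y x).
Proof. by rewrite hermC mul1r. Qed.

Lemma hdotZl a x y : hdot (a *: x) y = a * hdot x y.
Proof. exact: linearZl_LR. Qed.

Lemma hdotZr a x y : hdot x (a *: y) = Num.conj a * hdot x y.
Proof. exact: linearZr_LR. Qed.

Lemma hdot_eq0C x y : hdot x y = 0 -> hdot y x = 0.
Proof. by move=> xy; rewrite hdotC xy rmorph0. Qed.

Lemma sqr_nrm x : (nrm x ^+ 2)%:C = hdot x x.
Proof. by rewrite hdot_norm nrmE rmorphXn. Qed.

Lemma hdot_eq0 x : hdot x x = 0 -> x = 0.
Proof. by move/eqP; rewrite hdot_norm sqrf_eq0 normr_eq0 => /eqP. Qed.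

Lemma parallelogram x y :
  nrm (x + y) ^+ 2 + nrm (x - y) ^+ 2 = 2 * nrm x ^+ 2 + 2 * nrm y ^+ 2.
Proof.
apply: complexI; rewrite ![2 * _]mulr_natl !mulr2n !rmorphD /= !sqr_nrm.
rewrite !linearDl !linearDr /= !linearNl !linearNr /=; ring.
Qed.

Lemma pythagoras x y : hdot x y = 0 ->
  nrm (x + y) ^+ 2 = nrm x ^+ 2 + nrm y ^+ 2.
Proof.
move=> xy; apply: complexI; rewrite rmorphD /= !sqr_nrm.
by rewrite !linearDl !linearDr /= xy (hdot_eq0C xy); ring.
Qed.

(** Gram determinant of x and y: the squared distance from x to the line of y, times the squared
    norm of y. Its sign gives Cauchy-Schwarz, and it also shows that removing the component along y
    does not increase the norm. *)
Lemma sqr_nrm_reject x y : y != 0 ->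
  nrm (x - (hdot x y / hdot y y) *: y) ^+ 2 * nrm y ^+ 2 =
  nrm x ^+ 2 * nrm y ^+ 2 - nrm (hdot x y : R[i]^o) ^+ 2.
Proof.
move=> y0; apply: complexI.
have yy0 : hdot y y != 0 by rewrite hdot_norm sqrf_eq0 normr_eq0.
rewrite rmorphB /= ![(_ ^+ 2 * _ ^+ 2)%:C]rmorphM /= !sqr_nrm.
rewrite rmorphXn /= -nrmE normCK.
rewrite linearBl !linearBr /= !hdotZl !hdotZr (hdotC y x).
rewrite fmorph_div /= -(hdotC y y); field; exact: yy0.
Qed.

Lemma cauchy_schwarz x y : nrm (hdot x y : R[i]^o) <= nrm x * nrm y.
Proof.
have [->|y0] := eqVneq y 0; first by rewrite linear0r !nrm0 mulr0.
rewrite -ler_sqr ?nnegrE ?mulr_ge0 ?nrm_ge0// exprMn -subr_ge0.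
by rewrite -sqr_nrm_reject// mulr_ge0// sqr_ge0.
Qed.

Lemma closed_orthogonal_complement M : closed (orthogonal_complement M).
Proof.
apply/closed_nrmP => x xM y My; apply: (@nrm_lt_eps R R[i]^o) => e e0.
have d0 : 0 < nrm y + 1 by rewrite ltr_wpDl ?nrm_ge0.
have [|z zM xz] := xM (e / (nrm y + 1)); first by rewrite divr_gt0.
rewrite -[hdot y x]subr0 -(zM y My) -linearBr /=.
apply: le_lt_trans (cauchy_schwarz _ _) _.
rewrite ltr_pdivlMr// mulrC in xz; apply: le_lt_trans xz.
by rewrite ler_wpM2r ?nrm_ge0// lerDl.
Qed.

(** Removing the component of x along y would shorten x strictly unless [hdot x y] vanishes. *)
Lemma orthogonal_of_minimal M x : submodule M ->
  (forall y, M y -> nrm x <= nrm (x - y)) -> orthogonal_complement M x.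
Proof.
move=> sM xmin y My; have [->|y0] := eqVneq y 0; first by rewrite linear0l.
apply/hdot_eq0C/(@nrm_eq0 R R[i]^o)/eqP.
rewrite -sqrf_eq0 eq_le sqr_ge0 andbT.
have := xmin _ (submoduleZ sM (hdot x y / hdot y y) My).
rewrite -ler_sqr ?nnegrE ?nrm_ge0// => /(ler_wpM2r (sqr_ge0 (nrm y))).
rewrite sqr_nrm_reject//; lra.
Qed.

(** A minimising sequence for the distance from x to [M] is Cauchy by the parallelogram law, because
    midpoints stay in [M]; its limit attains the distance. *)
Theorem orthogonal_projection M x : closed M -> submodule M ->
  exists2 m, M m & orthogonal_complement M (x - m).
Proof.
move=> cM sM; pose D := [set nrm (x - m) | m in M].
have infD : has_inf D.
  split; first by exists (nrm (x - 0)), 0 => //; exact: submodule0.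
  by exists 0 => _ [m _ <-]; exact: nrm_ge0.
pose d := inf D; have dle m : M m -> d <= nrm (x - m).
  by move=> Mm; apply: ge_inf; [exact: infD.2|exists m].
have d0 : 0 <= d by apply: lb_le_inf infD.1 _ => _ [m _ <-]; exact: nrm_ge0.
have near_d n : exists m, M m /\ nrm (x - m) ^+ 2 < d ^+ 2 + n.+1%:R^-1.
  pose s := Num.sqrt (d ^+ 2 + n.+1%:R^-1).
  have n0 : 0 < n.+1%:R^-1 :> R by rewrite invr_gt0.
  have ds : d < s.
    by rewrite -[d]ger0_norm// -sqrtr_sqr ltr_sqrt ?ltrDl// ltr_wpDl ?sqr_ge0.
  have [_ [m Mm <-]] := inf_lt infD.1 ds.
  move=> ms; exists m; split=> //.
  rewrite -[ltRHS]sqr_sqrtr ?addr_ge0 ?sqr_ge0 ?ltW//.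
  by rewrite ltr_sqr ?nnegrE ?nrm_ge0// (le_trans d0)// ltW.
have [u uP] := choice near_d.
have mid m m' : M m -> M m' ->
    nrm (m - m') ^+ 2 <=
    2 * (nrm (x - m) ^+ 2 + nrm (x - m') ^+ 2 - 2 * d ^+ 2).
  move=> Mm Mm'; have := parallelogram (x - m') (x - m).
  have -> : x - m' - (x - m) = m - m' by rewrite opprB addrC addrA subrK.
  have -> : x - m' + (x - m) = 2%:C *: (x - 2^-1 *: (m + m')).
    rewrite scalerBr scalerA rmorph_nat divff ?pnatr_eq0// scale1r.
    by rewrite scaler_nat mulr2n opprD addrACA [- m' - m]addrC.
  rewrite nrmZr exprMn ger0_norm//.
  have : d ^+ 2 <= nrm (x - 2^-1 *: (m + m')) ^+ 2.
    rewrite ler_sqr ?nnegrE ?nrm_ge0//; apply: dle.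
    by apply: submoduleZ => //; exact: submoduleD.
  lra.
have inv_small (e : R) : 0 < e ->
    exists N, forall n, (N <= n)%N -> n.+1%:R^-1 < e.
  move=> e0; exists (Num.truncn e^-1) => n Nn.
  rewrite -[ltRHS]invrK ltf_pV2 ?posrE ?invr_gt0//.
  by apply: lt_le_trans (truncnS_gt _) _; rewrite ler_nat ltnS.
have [|m um] := @cauchy_nrm_cvg _ U u.
  (* Two squared distances below d^2 + e^2/4 give, by [mid], a gap whose square is below e^2. *)
  move=> e e0; have [|N NP] := inv_small (e ^+ 2 / 4).
    by rewrite divr_gt0// exprn_gt0.
  exists N => i j Ni Nj; rewrite -ltr_sqr ?nnegrE ?nrm_ge0 ?ltW//.
  have [Mi ui] := uP i; have [Mj uj] := uP j.
  apply: le_lt_trans (mid _ _ Mi Mj) _.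
  have := NP i Ni; have := NP j Nj.
  move: (i.+1%:R^-1) (j.+1%:R^-1) ui uj => a b; lra.
have Mm : M m.
  apply: (closed_nrmP M).1 => // e e0; have [N NP] := um e e0.
  by exists (u N); [exact: (uP N).1|rewrite nrm_distC NP].
exists m => //; apply: orthogonal_of_minimal => // y My.
rewrite -addrA -opprD; apply: le_trans (dle _ _); last first.
  exact: submoduleD.
apply/ler_addgt0Pr => e e0.
have [N NP] := um (e / 2) (divr_gt0 e0 (ltr0n _ 2)).
(* d^2 + e^2/4 is at most (d + e/2)^2, and [m] is within e/2 of the sequence, so its distance to x
   is at most d + e. *)
have [|N' NP'] := inv_small (e ^+ 2 / 4); first by rewrite divr_gt0// exprn_gt0.
have [_ un] := uP (maxn N N').
have xu : nrm (x - u (maxn N N')) < d + e / 2.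
  rewrite -ltr_sqr ?nnegrE ?nrm_ge0 ?addr_ge0// ?ltW ?divr_gt0//.
  apply: (lt_le_trans un).
  have de : 0 <= d * e by rewrite mulr_ge0// ltW.
  have := NP' _ (leq_maxr N N'); move: (_.+1%:R^-1) => a.
  by rewrite sqrrD expr_div_n; lra.
have := NP _ (leq_maxl N N'); have := nrm_triangle (u (maxn N N')) x m.
by lra.
Qed.

End InnerProduct.

(** * Finite-dimensional subspaces *)

Section Span.
Variables (K : pzRingType) (V : lmodType K).
Implicit Types (s t : seq V) (M : set V).

(** Recursion on the list allows induction on the number of generators; [finite_dimensionalP] links
    it to indexed linear combinations. *)
Fixpoint lspan s : set V :=
  if s is b :: s' then [set x | exists c w, lspan s' w /\ x = c *: b + w]
  else [set 0].

Lemma submodule_lspan s : submodule (lspan s).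
Proof.
elim: s => [|b s IH]; split.
- by [].
- by move=> a x y /= -> ->; rewrite scaler0 addr0.
- by exists 0, 0; rewrite scale0r addr0; split=> //; exact: submodule0.
- move=> a _ _ [c [w [sw ->]]] [d [v [sv ->]]].
  exists (a * c + d), (a *: w + v); split; first exact: submoduleP.
  by rewrite scalerDl scalerDr scalerA addrACA.
Qed.

Lemma lspan_mem s x : x \in s -> lspan s x.
Proof.
elim: s => //= b s IH; rewrite inE => /predU1P[->|/IH sx].
  by exists 1, 0; split;
    [exact: submodule0 (submodule_lspan s)|rewrite scale1r addr0].
by exists 0, x; rewrite scale0r add0r.
Qed.

Lemma lspan_min s M : submodule M -> (forall x, x \in s -> M x) ->
  lspan s `<=` M.
Proof.
move=> sM; elim: s => [_ _ ->|b s IH sbM _ [c [w [sw ->]]]].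
  exact: submodule0.
apply: submoduleP => //; first by apply: sbM; rewrite mem_head.
by apply: IH sw => x sx; apply: sbM; rewrite inE sx orbT.
Qed.

Lemma lspan_cat s t x y : lspan s x -> lspan t y -> lspan (s ++ t) (x + y).
Proof.
move=> sx ty; apply: (submoduleD (submodule_lspan _)).
  by apply: lspan_min sx => [|z sz]; [exact: submodule_lspan|
    apply: lspan_mem; rewrite mem_cat sz].
by apply: lspan_min ty => [|z tz]; [exact: submodule_lspan|
  apply: lspan_mem; rewrite mem_cat tz orbT].
Qed.

Lemma submodule_sum M n (c : 'I_n -> K) (b : 'I_n -> V) : submodule M ->
  (forall i, M (b i)) -> M (\sum_(i < n) c i *: b i).
Proof.
move=> sM Mb; apply: (big_ind M); first exact: submodule0.
  by move=> x y; exact: submoduleD.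
by move=> i _; exact: submoduleZ.
Qed.

Lemma submodule_add M N : submodule M -> submodule N ->
  submodule [set x + y | x in M & y in N].
Proof.
move=> sM sN; split.
  by exists 0; [exact: submodule0|exists 0; [exact: submodule0|rewrite addr0]].
move=> a _ _ [x Mx [y Ny <-]] [x' Mx' [y' Ny' <-]].
exists (a *: x + x'); first exact: submoduleP.
exists (a *: y + y'); first exact: submoduleP.
by rewrite scalerDr addrACA.
Qed.

End Span.

Lemma lspan_map (K : pzRingType) (V W : lmodType K) (f : {linear V -> W}) s :
  f @` lspan s = lspan (map f s).
Proof.
elim: s => [|b s IH] /=; first by rewrite image_set1 linear0.
apply/seteqP; split=> [_ [_ [c [w [sw ->]]] <-]|_ [c [w [+ ->]]]].
  by exists c, (f w); rewrite linearP -IH; split=> //; exists w.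
rewrite -IH => -[v sv <-]; exists (c *: b + v); last by rewrite linearP.
by exists c, v.
Qed.

Lemma finite_dimensionalP (C : numClosedFieldType) (U : hilbertType C)
  (E : set U) : finite_dimensional E <-> exists s, E = lspan s.
Proof.
split=> [[n [b ->]]|[s ->]].
  exists (codom b); apply/seteqP; split=> [_ [c ->]|].
    by apply: submodule_sum => [|i]; [exact: submodule_lspan|
      exact/lspan_mem/codom_f].
  apply: lspan_min => [|_ /codomP[i ->]].
    split=> [|a _ _ [c ->] [d ->]].
      by exists (fun=> 0); rewrite big1// => i _; rewrite scale0r.
    exists (fun i => a * c i + d i); rewrite scaler_sumr -big_split /=.
    by apply: eq_bigr => i _; rewrite scalerDl scalerA.
  exists (fun j => (j == i)%:R); rewrite (bigD1 i)//= eqxx scale1r.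
  rewrite big1 ?addr0//.
  by move=> j /negbTE ->; rewrite scale0r.
exists (size s), (fun i => nth 0 s i); elim: s => [|b s IH] /=.
  apply/seteqP; split=> [_ ->|_ [c ->]]; last by rewrite big_ord0.
  by exists (fun=> 0); rewrite big_ord0.
rewrite IH; apply/seteqP; split=> [_ [c [_ [[d ->] ->]]]|_ [c ->]].
  exists (fun i => if unlift ord0 i is Some j then d j else c).
  rewrite big_ord_recl unlift_none /=; congr (_ + _).
  by apply: eq_bigr => i _; rewrite liftK.
exists (c ord0), (\sum_(i < size s) c (lift ord0 i) *: nth 0 s i).
by rewrite big_ord_recl; split=> //; exists (c \o lift ord0).
Qed.

(** A map with finite-dimensional image on [X] has a kernel of finite codimension in [X]. Induction
    on [s]: either [X] already maps into the span of the tail, or some e in [X] has a non-zero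
    coefficient at b, and multiples of e bring every x in [X] back to that case. *)
Lemma finite_codim_kernel (K : fieldType) (V W : lmodType K)
    (f : {linear V -> W}) (s : seq W) (X : set V) : submodule X ->
  (forall x, X x -> lspan s (f x)) ->
  exists t, (forall x, x \in t -> X x) /\
    forall x, X x -> exists2 w, lspan t w & f (x - w) = 0.
Proof.
elim: s X => [|b s IH] X sX fX.
  exists [::]; split=> // x Xx; exists 0 => //.
  by rewrite subr0; exact: fX.
pose Y := X `&` [set x | lspan s (f x)].
have sY : submodule Y.
  split=> [|a x y [Xx sx] [Xy sy]].
    split; first exact: submodule0.
    by rewrite /= linear0; exact: submodule0 (submodule_lspan s).
  split; first exact: submoduleP.
  by rewrite /= linearP; apply: (submoduleP (submodule_lspan s)).
have [|t [tY tP]] := IH Y sY; first by move=> x [].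
have [XY|] := pselect (X `<=` Y).
  exists t; split=> [x /tY[]//|x /XY]; exact: tP.
move=> /existsNP[e /not_implyP[Xe Ye]].
have [c [w [sw fe]]] := fX e Xe.
have c0 : c != 0.
  apply/eqP => c0; apply: Ye; split=> //=.
  by rewrite fe c0 scale0r add0r.
exists (e :: t); split=> [x|x Xx].
  by rewrite inE => /predU1P[->//|/tY[]].
have [d [v [sv fx]]] := fX x Xx.
(* The factor d / c cancels the coefficient of [f x] at b. *)
have [|u tu fu] := tP (x - (d / c) *: e).
  split; first by apply: submoduleB => //; exact: submoduleZ.
  rewrite /= linearB linearZ /= fx fe scalerDr scalerA divfK// opprD addrACA.
  rewrite subrr add0r; apply: (submoduleB (submodule_lspan s)) => //.
  exact: (submoduleZ (submodule_lspan s)).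
exists ((d / c) *: e + u); last by rewrite opprD addrA.
by exists (d / c), u.
Qed.

(** For the identity map the kernel is zero, so [finite_codim_kernel] yields generators of [M]
    itself. *)
Lemma lspan_submodule (K : fieldType) (V : lmodType K) (s : seq V) (M : set V) :
  submodule M -> M `<=` lspan s -> exists t, M = lspan t.
Proof.
move=> sM Ms; have [t [tM tP]] := @finite_codim_kernel _ _ _ idfun s M sM Ms.
exists t; apply/seteqP; split=> [x /tP[w tw]|].
  by move=> /eqP; rewrite subr_eq0 => /eqP ->.
exact: lspan_min.
Qed.

(** * Closedness of finite-dimensional extensions, and density *)

Section HilbertSpace.
Variables (R : realType).
Implicit Types (U V : hilbertType R[i]).

(** The part b' of b orthogonal to [M] generates the same sum. If b' is non-zero, x is in the sum
    exactly when x minus its component along b' lies in [M]. This map r does not increase norms, so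
    the preimage of [M] is closed. *)
Lemma closed_add_line U (M : set U) b : closed M -> submodule M ->
  closed [set x + y | x in M & y in lspan [:: b]].
Proof.
move=> cM sM; have [m Mm mb] := orthogonal_projection b cM sM.
have bE : b = m + (b - m) by rewrite addrC subrK.
pose b' := b - m; rewrite -/b' in mb bE.
have [b0|b0] := eqVneq b' 0.
  rewrite b0 addr0 in bE; rewrite (_ : [set _ | _ in _ & _ in _] = M)//.
  apply/seteqP; split=> [_ [x Mx [_ [c [_ [-> ->]]] <-]]|x Mx].
    by rewrite addr0; apply: submoduleD => //; apply: submoduleZ; rewrite ?bE.
  by exists x => //; exists 0;
    [exact: submodule0 (submodule_lspan _)|rewrite addr0].
have bb0 : hdot b' b' != 0 by rewrite hdot_norm sqrf_eq0 normr_eq0.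
pose r x := x - (hdot x b' / hdot b' b') *: b'.
rewrite (_ : [set _ | _ in _ & _ in _] = [set x | M (r x)]); last first.
  apply/seteqP; split=> [_ [x Mx [_ [c [_ [-> ->]]] <-]]|x Mx].
    have -> : x + (c *: b + 0) = (c *: m + x) + c *: b'.
      by rewrite addr0 {1}bE scalerDr addrCA addrA.
    have Mcx : M (c *: m + x) by exact: submoduleP.
    by rewrite /= /r linearDl /= (mb _ Mcx) add0r hdotZl mulfK// addrK.
  exists (r x - (hdot x b' / hdot b' b') *: m).
    by apply: submoduleB => //; exact: submoduleZ.
  exists ((hdot x b' / hdot b' b') *: b); last first.
    by rewrite {1}bE scalerDr addrA subrK subrK.
  by exists (hdot x b' / hdot b' b'), 0; rewrite addr0.
apply/closed_nrmP => x xM; apply: (closed_nrmP M).1 => // e /xM[z Mz xz].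
exists (r z) => //; apply: le_lt_trans xz.
have -> : r x - r z = r (x - z).
  rewrite /r (_ : hdot (x - z) b' = hdot x b' - hdot z b').
    2: exact: linearBl.
  by rewrite mulrBl scalerBl !opprB addrACA [RHS]addrACA [- z - _]addrC.
have b'0 : 0 < nrm b' ^+ 2.
  rewrite exprn_gt0// lt_def nrm_ge0 andbT.
  by apply: contra_neq b0; exact: nrm_eq0.
rewrite -ler_sqr ?nnegrE ?nrm_ge0// -(ler_pM2r b'0) sqr_nrm_reject//.
by rewrite lerBlDr lerDl sqr_ge0.
Qed.

Lemma closed_add_lspan U (M : set U) s : closed M -> submodule M ->
  closed [set x + y | x in M & y in lspan s].
Proof.
elim: s M => [|b s IH] M cM sM.
  rewrite (_ : [set _ | _ in _ & _ in _] = M)//.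
  apply/seteqP; split=> [_ [x Mx [_ -> <-]]|x Mx]; first by rewrite addr0.
  by exists x => //; exists 0; rewrite ?addr0.
have := IH _ (closed_add_line (b := b) cM sM)
  (submodule_add sM (submodule_lspan [:: b])).
rewrite (_ : [set x + y | x in [set x + y | x in M & y in lspan [:: b]]
                    & y in lspan s] =
  [set x + y | x in M & y in lspan (b :: s)])//.
apply/seteqP; split=> [_ [_ [x Mx [_ [c [_ [-> ->]]] <-]] [y sy <-]]|].
  by exists x => //; exists (c *: b + y); [exists c, y|rewrite addr0 addrA].
move=> _ [x Mx [_ [c [y [sy ->]]] <-]]; exists (x + c *: b).
  by exists x => //; exists (c *: b) => //; exists c, 0; rewrite addr0.
by exists y; rewrite ?addrA.
Qed.

Lemma closed_lspan U (s : seq U) : closed (lspan s).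
Proof.
have := @closed_add_lspan U [set 0] s.
rewrite (_ : [set _ | _ in _ & _ in _] = lspan s).
  apply; first by apply/closed_nrmP => x x0; apply: nrm_lt_eps => e /x0[_ ->];
    rewrite subr0.
  by split=> // a _ _ -> ->; rewrite scaler0 addr0.
apply/seteqP; split=> [_ [_ -> [y sy <-]]|y sy]; first by rewrite add0r.
by exists 0 => //; exists y; rewrite ?add0r.
Qed.

(** The closure [N] is a closed subspace, and x minus its projection on [N] is orthogonal to [M],
    hence zero. *)
Lemma dense_of_trivial_complement U (M : set U) : submodule M ->
  (forall x, orthogonal_complement M x -> x = 0) ->
  forall x (e : R), 0 < e -> exists2 z, M z & nrm (x - z) < e.
Proof.
move=> sM M0; pose N :=
  [set x | forall e : R, 0 < e -> exists2 z, M z & nrm (x - z) < e].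
have MN : M `<=` N by move=> x Mx e e0; exists x; rewrite ?subrr ?nrm0.
have cN : closed N.
  apply/closed_nrmP => x xN e e0.
  have e20 : 0 < e / 2 by rewrite divr_gt0.
  have [y Ny xy] := xN _ e20; have [z Mz yz] := Ny _ e20.
  by exists z => //; have := nrm_triangle y x z; lra.
have sN : submodule N.
  split=> [|a x y Nx Ny e e0]; first by apply: MN; exact: (submodule0 sM).
  have a0 : 0 < nrm (a : R[i]^o) + 1 by rewrite ltr_wpDl ?nrm_ge0.
  have [|x' Mx' xx'] := Nx (e / 2 / (nrm (a : R[i]^o) + 1)).
    by rewrite !divr_gt0.
  have [|y' My' yy'] := Ny (e / 2); first by rewrite divr_gt0.
  exists (a *: x' + y'); first exact: submoduleP.
  have -> : a *: x + y - (a *: x' + y') = a *: (x - x') + (y - y').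
    by rewrite scalerBr opprD addrACA.
  apply: le_lt_trans (nrmD _ _) _; rewrite nrmZ.
  rewrite ltr_pdivlMr// mulrDr mulr1 [_ * nrm _]mulrC in xx'.
  have := nrm_ge0 (x - x'); lra.
move=> x; have [m Nm xm] := orthogonal_projection x cN sN.
suff -> : x = m by [].
apply/eqP; rewrite -subr_eq0; apply/eqP/M0 => y /MN; exact: xm.
Qed.

End HilbertSpace.

(** * Uniform boundedness and closed graph *)

Section UniformBoundedness.
Variables (R : realType) (U : hilbertType R[i]).
Implicit Types (x a : U) (E : set U).

Local Notation cnorm z := (nrm (z : R[i]^o)).

(** With v of length d along a, the pairings of x + v and x - v with a differ by twice d times the
    norm of a, so one of them is large enough. *)
Lemma gliding_step x a (d : R) : 0 < d -> 0 < nrm a ->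
  exists y, nrm (y - x) <= d /\ d * nrm a <= cnorm (hdot y a).
Proof.
move=> d0 a0; pose v := (d / nrm a)%:C *: a.
have vd : nrm v = d by rewrite nrmZr ger0_norm ?divr_ge0 ?ltW// divfK// gt_eqF.
have va : cnorm (hdot v a) = d * nrm a.
  rewrite hdotZl -sqr_nrm -rmorphM /= nrm_real ger0_norm.
    by field; rewrite gt_eqF.
  by rewrite mulr_ge0 ?sqr_ge0// divr_ge0 ?ltW.
have : 2 * cnorm (hdot v a) <= cnorm (hdot (x + v) a) + cnorm (hdot (x - v) a).
  have -> : 2 * cnorm (hdot v a) = cnorm (hdot (x + v) a - hdot (x - v) a).
    have -> : hdot (x + v) a - hdot (x - v) a = (2 : R)%:C * hdot v a.
      rewrite linearBl linearDl /= rmorph_nat; ring.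
    by rewrite (@nrmZr R R[i]^o) ger0_norm.
  apply: le_trans (@nrmD R R[i]^o _ _) _.
  by rewrite (@nrmN R R[i]^o).
rewrite va => sum2; have [h|h] := leP (d * nrm a) (cnorm (hdot (x + v) a)).
  by exists (x + v); rewrite addrAC subrr add0r vd.
exists (x - v); rewrite addrAC subrr add0r nrmN vd; split=> //; lra.
Qed.

(* Sokal's gliding hump argument: a sequence x_n with steps of length 4^-n is
   built so that |<x_(n+1), a_n>| >= 4^-n |a_n|; the remaining steps, of total
   length 4^-n / 3, cannot destroy this. *)
Theorem weakly_bounded E :
  (forall x, exists M : R, forall a, E a -> cnorm (hdot x a) <= M) ->
  exists M : R, forall a, E a -> nrm a <= M.
Proof.
move=> wE; apply: contrapT => /forallNP uE.
(* The factor 4^n offsets the step length 4^-n, so that the pairings grow at least like a multiple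
   of n. *)
have /choice[a aP] n : exists y, E y /\ n%:R * 4 ^+ n < nrm y.
  have /existsNP[y /not_implyP[Ey /negP]] := uE (n%:R * 4 ^+ n).
  by rewrite -ltNge; exists y.
have a0 n : 0 < nrm (a n).
  by apply: le_lt_trans (aP n).2; rewrite mulr_ge0// exprn_ge0.
pose d n : R := (4 ^+ n)^-1.
have d0 n : 0 < d n by rewrite invr_gt0 exprn_gt0.
have dS n : d n.+1 = d n / 4 by rewrite /d exprS invfM mulrC.
have /choice[next nextP] (p : nat * U) : exists y,
    nrm (y - p.2) <= d p.1 /\ d p.1 * nrm (a p.1) <= cnorm (hdot y (a p.1)).
  exact: gliding_step.
pose x := fix x n := if n is m.+1 then next (m, x m) else 0.
(* The bound is the partial geometric sum of the steps from n to n + k - 1. *)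
have xtail n k : nrm (x (n + k)%N - x n) <= 4 / 3 * (d n - d (n + k)%N).
  elim: k => [|k IH]; first by rewrite addn0 !subrr mulr0 nrm0.
  rewrite addnS dS; have := nrm_triangle (x (n + k)%N) (x (n + k).+1) (x n).
  have := (nextP ((n + k)%N, x (n + k)%N)).1; rewrite -/(x (n + k).+1) /=; lra.
have xtail' n k : nrm (x (n + k)%N - x n) <= 4 / 3 * d n.
  by have := xtail n k; have := d0 (n + k)%N; lra.
have d_small (e : R) : 0 < e -> exists n, d n < e.
  move=> e0; exists (Num.truncn e^-1).+1; rewrite /d.
  rewrite -[ltRHS]invrK ltf_pV2 ?posrE ?invr_gt0 ?exprn_gt0//.
  apply: lt_trans (truncnS_gt _) _; rewrite -natrX ltr_nat; exact: ltn_expl.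
have [|l xl] := @cauchy_nrm_cvg _ U x.
  (* Two tails, each below 4/3 times 3/8 e, add up to less than e. *)
  move=> e e0; have [|N dN] := d_small (3 / 8 * e); first lra.
  exists N => m n Nm Nn; have := nrm_triangle (x N) (x m) (x n).
  rewrite [nrm (x N - _)]nrm_distC -(subnKC Nm) -(subnKC Nn).
  by have := xtail' N (m - N)%N; have := xtail' N (n - N)%N; lra.
have [M lM] := wE l.
(* The pairing of [l] with [a n] will exceed (1 - 1/3) n, so M > 2n/3; this is incompatible with n >
   2M. *)
pose n := (Num.truncn (2 * M)).+1.
have nM : 2 * M < n%:R by exact: truncnS_gt.
have lx : nrm (x n.+1 - l) <= d n / 3.
  apply/ler_addgt0Pr => e e0; have [N NP] := xl e e0.
  have := NP (n.+1 + N)%N (leq_addl _ _).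
  have := xtail' n.+1 N; rewrite dS nrm_distC.
  by have := nrm_triangle (x (n.+1 + N)%N) (x n.+1) l; lra.
have := lM _ (aP n).1; have := (nextP (n, x n)).2; rewrite -/(x n.+1) /=.
have : cnorm (hdot (x n.+1) (a n)) <=
    cnorm (hdot l (a n)) + nrm (x n.+1 - l) * nrm (a n).
  apply: le_trans (lerD (lexx _) (cauchy_schwarz _ _)).
  have {1}-> : x n.+1 = l + (x n.+1 - l) by rewrite addrC subrK.
  by rewrite linearDl; exact: (@nrmD R R[i]^o).
have := ler_wpM2r (ltW (a0 n)) lx.
have : n%:R < d n * nrm (a n)
  by rewrite mulrC ltr_pdivlMr ?exprn_gt0// (aP n).2.
have : 0 <= n%:R :> R by [].
rewrite mulrAC; lra.
Qed.

End UniformBoundedness.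

Section ClosedGraph.
Variable R : realType.
Implicit Types U V : hilbertType R[i].

Local Notation cnorm z := (nrm (z : R[i]^o)).

(** The two sides refer to different norms, the Hilbert sum norm and the maximum norm, which are
    equivalent. *)
Lemma closed_hsumE U V (E : set (U * V)) :
  closed (E : set (hsum U V)) <-> closed E.
Proof.
rewrite closed_pairP closed_nrmP; split=> [EP x y xyE|EP [x y] xyE].
  apply: EP => e e0; have [|[x' y'] [Ep xx' yy']] := xyE (e / 2).
    by rewrite divr_gt0.
  exists (x', y') => //; have : nrm ((x, y) - (x', y') : hsum U V) <=
      nrm (x - x') + nrm (y - y').
    by rewrite -lecR rmorphD /= -!nrmE; exact: hsum_norm_le.
  by rewrite /= in xx' yy' *; lra.
apply: EP => e /xyE[[x' y'] Ep xye]; exists (x', y'); split=> //=.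
- apply: le_lt_trans xye; rewrite -lecR -!nrmE.
  exact: (hsum_norm1 ((x, y) - (x', y') : hsum U V)).
- apply: le_lt_trans xye; rewrite -lecR -!nrmE.
  exact: (hsum_norm2 ((x, y) - (x', y') : hsum U V)).
Qed.

(** The proof passes through the adjoint: its domain [A] is dense because the graph is closed, and
    it is bounded by [weakly_bounded], since the pairing of x with an adjoint value at y is that of
    [G x] with y. Pairing [G x] with elements of [A] close to it bounds [G]. *)
Theorem closed_graph U V (G : {linear U -> V}) :
  closed [set p : U * V | p.2 = G p.1] ->
  exists M : R, forall x, nrm (G x) <= M * nrm x.
Proof.
move=> cG; pose gr : set (hsum U V) := [set p | p.2 = G p.1].
have cgr : closed gr by exact/closed_hsumE.
have sgr : submodule gr.
  split=> [|a x y xG yG]; first by rewrite /gr /= linear0.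
  by rewrite /gr /= linearP xG yG.
pose adj y z := forall x, hdot (G x) y = hdot x z.
have adjP a y z y' z' : adj y z -> adj y' z' -> adj (a *: y + y') (a *: z + z').
  by move=> yz yz' x; rewrite !linearDr !linearZr_LR /= yz yz'.
pose A := [set y | exists z, adj y z].
have sA : submodule A.
  split=> [|a y y' [z yz] [z' yz']]; first by exists 0 => x; rewrite !linear0r.
  by exists (a *: z + z'); exact: adjP.
have A0 w : orthogonal_complement A w -> w = 0.
  move=> Aw.
  (* The residual (-x, b), with b = w - G x, is orthogonal to the graph, so x is the adjoint value
     at b. As w is orthogonal to b, the squared norms of x and b sum to zero, which leaves w = 0. *)
  have [[x y] xy xwG] := orthogonal_projection ((0, w) : hsum U V) cgr sgr.
  have {xy} yE : y = G x := xy; rewrite {y}yE in xwG.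
  pose b := w - G x.
  have bx : adj b x.
    move=> u; have /= := xwG (u, G u) erefl.
    rewrite hsum_dotE /= -/b sub0r linearNr => /eqP.
    by rewrite addrC subr_eq0 => /eqP.
  have wb : hdot w b = 0 by apply: hdot_eq0C; apply: Aw; exists x.
  have /eqP : hdot x x + hdot b b = 0.
    have := bx x; have -> : G x = w - b by rewrite /b opprB addrC subrK.
    by rewrite linearBl /= wb sub0r => <-; rewrite addrC subrr.
  rewrite !hdot_norm paddr_eq0 ?exprn_ge0// !sqrf_eq0 !normr_eq0.
  by move=> /andP[/eqP x0]; rewrite /b x0 linear0 subr0 => /eqP.
have dA := dense_of_trivial_complement sA A0.
have [M adjM] : exists M : R, forall z,
    (exists2 y, nrm y <= 1 & adj y z) -> nrm z <= M.
  apply: (@weakly_bounded R U [set z | exists2 y, nrm y <= 1 & adj y z]) => x.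
  exists (nrm (G x)) => z [y y1 yz]; rewrite -yz.
  apply: le_trans (cauchy_schwarz _ _) _.
  by rewrite -[leRHS]mulr1 ler_wpM2l ?nrm_ge0.
have M0 : 0 <= M.
  apply: le_trans (nrm_ge0 (0 : U)) _; apply: adjM.
  by exists 0; rewrite ?nrm0// => x; rewrite !linear0r.
have adjM' y z : adj y z -> nrm z <= M * nrm y.
  move=> yz; have [y0|y0] := eqVneq y 0.
    rewrite y0 nrm0 mulr0 (_ : z = 0) ?nrm0//; apply: hdot_eq0.
    by rewrite -yz y0 linear0r.
  have ny0 : 0 < nrm y.
    by rewrite lt_def nrm_ge0 andbT; apply: contra_neq y0; exact: nrm_eq0.
  have := adjM ((nrm y)^-1%:C *: z).
  rewrite nrmZr ger0_norm ?invr_ge0 ?nrm_ge0//.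
  rewrite ler_pdivrMl// mulrC; apply.
  exists ((nrm y)^-1%:C *: y) => [|x].
    by rewrite nrmZr ger0_norm ?invr_ge0 ?nrm_ge0// mulVf// gt_eqF.
  by rewrite !hdotZr yz.
exists M => x; have [->|Gx0] := eqVneq (nrm (G x)) 0.
  by rewrite mulr_ge0 ?nrm_ge0.
have nG0 : 0 < nrm (G x) by rewrite lt_def nrm_ge0 andbT.
rewrite -(ler_pM2r nG0); apply/ler_addgt0Pr => e e0.
have Mx0 : 0 <= M * nrm x by rewrite mulr_ge0 ?nrm_ge0.
have k0 : 0 < M * nrm x + nrm (G x) by lra.
(* Replacing [G x] by y costs at most this denominator times [nrm (G x - y)]. *)
have [y [z yz] Gy] := dA (G x) (e / (M * nrm x + nrm (G x))) (divr_gt0 e0 k0).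
rewrite ltr_pdivlMr// in Gy.
have yle := nrm_triangle (G x) y 0.
have : nrm (G x) * nrm (G x) <=
    cnorm (hdot (G x) y) + nrm (G x) * nrm (G x - y).
  rewrite -expr2 -[leLHS]ger0_norm ?sqr_ge0// -nrm_real sqr_nrm.
  apply: le_trans (lerD (lexx _) (cauchy_schwarz _ _)).
  have {2}-> : G x = y + (G x - y) by rewrite addrC subrK.
  by rewrite linearDr; exact: (@nrmD R R[i]^o).
have : cnorm (hdot (G x) y) <= nrm x * (M * nrm y).
  rewrite yz; apply: le_trans (cauchy_schwarz _ _) _.
  by rewrite ler_wpM2l ?nrm_ge0 ?adjM'.
rewrite !subr0 nrm_distC in yle.
have := ler_wpM2l Mx0 yle; lra.
Qed.

End ClosedGraph.

(** * Closed range *)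

Section ClosedRange.
Variables (R : realType).
Implicit Types U V : hilbertType R[i].

Lemma submodule_op_graph U V (T : operator U V) : submodule (op_graph T).
Proof. by split; [exact: op_graph0|exact: op_graph_linear]. Qed.

Lemma op_graphB U V (T : operator U V) x y x' y' :
  op_graph T (x, y) -> op_graph T (x', y') -> op_graph T (x - x', y - y').
Proof.
by move=> Txy Txy'; exact: (submoduleB (submodule_op_graph T) Txy Txy').
Qed.

Lemma submodule_ran U V (T : operator U V) : submodule (ran T).
Proof.
split=> [|a y y' [x xy] [x' xy']]; first by exists 0; exact: op_graph0.
by exists (a *: x + x'); exact: (op_graph_linear a xy xy').
Qed.

Lemma submodule_ker U V (T : operator U V) : submodule (ker T).
Proof.
split=> [|a x x' xT xT']; first exact: op_graph0.
rewrite /ker /= (_ : (_, _) = a *: (x, 0) + (x', 0)).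
  exact: (op_graph_linear a xT xT').
by congr (_, _); rewrite /= scaler0 addr0.
Qed.

Lemma closed_ker U V (T : operator U V) : closed_operator T -> closed (ker T).
Proof.
move=> cT; apply/closed_nrmP => x xT.
apply: (closed_pairP _).1 cT _ _ _ => e e0.
have [z zT xz] := xT e e0; exists (z, 0); split=> //=.
by rewrite subrr (@nrm0 R V).
Qed.

(** Project y on the range, then remove from a preimage its component in the kernel. *)
Lemma generalised_inverse_total U (T : operator U U) y :
  closed_operator T -> closed (ran T) ->
  exists x, op_graph (generalised_inverse T) (y, x).
Proof.
move=> cT cranT.
have [a [x0 x0a] ya] := orthogonal_projection y cranT (submodule_ran T).
have [k kT x0k] := orthogonal_projection x0 (closed_ker cT) (submodule_ker T).
exists (x0 - k); apply/generalised_inverseE; exists a, (y - a); split=> //.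
  by rewrite addrC subrK.
by have := op_graphB x0a kT; rewrite subr0.
Qed.

Lemma closed_generalised_inverse U (T : operator U U) :
  closed_operator T -> closed (ran T) ->
  closed_operator (generalised_inverse T).
Proof.
move=> cT cranT; apply/closed_pairP => y x yx.
have [a Ta ya] := orthogonal_projection y cranT (submodule_ran T).
apply/generalised_inverseE; exists a, (y - a); split=> //.
- by rewrite addrC subrK.
- apply: (closed_pairP _).1 cT _ _ _ => e /yx[[y' x'] [/= yx' yy' xx']].
  have [a' [z' [y'E z'T x'a' _]]] := (generalised_inverseE T y' x').1 yx'.
  exists (x', a'); split=> //=; apply: le_lt_trans yy'.
  (* The range component of y - y' is orthogonal to its cokernel component, so by Pythagoras a' is
     as close to a as y' is to y. *)
  have aza : hdot (a - a') ((y - a) - z') = 0.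
    have Taa' : ran T (a - a').
      by apply: (submoduleB (submodule_ran T)) => //; exists x'.
    by rewrite linearBr /= ya// z'T// subrr.
  rewrite -ler_sqr ?nnegrE ?nrm_ge0//.
  have -> : y - y' = (a - a') + ((y - a) - z').
    by rewrite y'E opprD addrACA [a + _]addrC subrK.
  by rewrite (pythagoras aza) lerDl sqr_ge0.
- apply: (closed_nrmP _).1 (@closed_orthogonal_complement _ _ (ker T)) _ _ => e.
  move=> /yx[[y' x'] [/= yx' _ xx']]; exists x' => //.
  by have [a' [z' []]] := (generalised_inverseE T y' x').1 yx'.
Qed.

(** The graph of T^# is total, functional and closed, so the closed graph theorem applies. The bound
    is on differences because [G] is returned as a plain function. *)
Lemma bounded_generalised_inverse U (T : operator U U) :
  closed_operator T -> closed (ran T) ->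
  exists G : U -> U, (forall y, op_graph (generalised_inverse T) (y, G y)) /\
    exists M : R, forall y z, nrm (G y - G z) <= M * nrm (y - z).
Proof.
move=> cT cranT.
have /choice[G GP] y := generalised_inverse_total y cT cranT.
have GE y x : op_graph (generalised_inverse T) (y, x) -> x = G y.
  by move=> yx; exact: op_graph_functional yx (GP y).
have linG : linear G.
  move=> a y z; symmetry; apply: GE.
  exact: (op_graph_linear a (GP y) (GP z)).
pose GL : {linear U -> U} := HB.pack G (GRing.isLinear.Build _ _ _ _ _ linG).
have [|M GM] := @closed_graph R U U GL.
  rewrite (_ : [set _ | _] = op_graph (generalised_inverse T)).
    exact: closed_generalised_inverse.
  by apply/seteqP; split=> [[y x] /= ->|[y x] yx]; [exact: GP|exact: GE].
exists G; split=> //; exists M => y z.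
by have := GM (y - z); rewrite linearB.
Qed.

(* With [T^#] the bounded generalised inverse, y is in the range of L exactly
   when (T^# y, y) is in L + ker T x 0, which is closed as ker T has finite
   dimension. *)
Lemma closed_ran_restriction U (T : operator U U) (L : set (U * U)) :
  semiFredholm_plus T -> submodule L -> closed L -> L `<=` op_graph T ->
  closed [set y | exists x, L (x, y)].
Proof.
move=> [cT cranT /finite_dimensionalP[s kerT]] sL cL LT.
have [G [GP [M GM]]] := bounded_generalised_inverse cT cranT.
have GT y : ran T y -> op_graph T (G y, y).
  move=> yT.
  have [a [z [yE zT Ga _]]] := (generalised_inverseE T y (G y)).1 (GP y).
  (* z = y - a lies both in the range and in its orthogonal complement. *)
  suff z0 : z = 0 by rewrite {2}yE z0 addr0.
  apply: hdot_eq0; apply: zT; rewrite (_ : z = y - a).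
    by apply: (submoduleB (submodule_ran T)) => //; exists (G y).
  by rewrite yE addrAC subrr add0r.
have lin1 : linear (fun x : U => (x, 0) : hsum U U).
  by move=> a x y; congr (_, _); rewrite /= scaler0 addr0.
pose in1 : {linear U -> hsum U U} :=
  HB.pack (fun x : U => (x, 0) : hsum U U)
    (GRing.isLinear.Build _ _ _ _ _ lin1).
pose Lk : set (hsum U U) :=
  [set p + q | p in (L : set (hsum U U)) & q in lspan (map in1 s)].
have cLk : closed (Lk : set (U * U)).
  by apply/closed_hsumE/closed_add_lspan => //; exact/closed_hsumE.
(* Two preimages of y under T, here x and [G y], differ by an element of the kernel. *)
have LkP y : (exists x, L (x, y)) <-> Lk (G y, y).
  split=> [[x xy]|[[x y'] xy [q]]].
    exists (x, y) => //; exists (in1 (G y - x)).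
      rewrite -lspan_map; exists (G y - x) => //; rewrite -kerT.
      have := op_graphB (GT y _) (LT _ xy); rewrite subrr; apply.
      by exists x; exact: LT.
    by congr (_, _); rewrite /= ?addr0// addrC subrK.
  rewrite -lspan_map => -[k sk <-] [_ /= y'E]; exists x.
  by rewrite -y'E addr0.
apply/closed_nrmP => y yL; apply/LkP.
apply: (closed_pairP _).1 cLk _ _ _ => e e0.
have k0 : 0 < `|M| + 1 :> R by rewrite ltr_wpDl.
have [z zL yz] := yL (e / (`|M| + 1)) (divr_gt0 e0 k0).
rewrite ltr_pdivlMr// mulrDr mulr1 in yz.
have Myz : M * nrm (y - z) <= nrm (y - z) * `|M|.
  by rewrite mulrC ler_wpM2l ?nrm_ge0// ler_norm.
have yzM : 0 <= nrm (y - z) * `|M| by rewrite mulr_ge0 ?nrm_ge0.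
exists (G z, z); split=> /=; first exact/LkP.
- by have := GM y z; have := nrm_ge0 (y - z); lra.
- by lra.
Qed.

End ClosedRange.

(** * The Schur complement *)

Section BoundedOperators.
Variable R : realType.
Implicit Types U V W : hilbertType R[i].

Lemma bounded_op_nrm U V (f : bounded_op U V) :
  exists2 M : R, 0 <= M & forall x, nrm (f x) <= M * nrm x.
Proof.
have [M M0 fM] := bop_bound_ge0 f; exists (complex.Re M).
  by rewrite -lecR RRe_real// ger0_real.
by move=> x; rewrite -lecR rmorphM /= (@RRe_real _ M) ?ger0_real// -!nrmE fM.
Qed.

Lemma hsum_nrm1 U V (x : hsum U V) : nrm x.1 <= nrm x.
Proof. by rewrite -lecR -!nrmE; exact: hsum_norm1. Qed.

Lemma hsum_nrm2 U V (x : hsum U V) : nrm x.2 <= nrm x.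
Proof. by rewrite -lecR -!nrmE; exact: hsum_norm2. Qed.

Lemma hsum_nrm_le U V (x : hsum U V) : nrm x <= nrm x.1 + nrm x.2.
Proof. by rewrite -lecR rmorphD /= -!nrmE; exact: hsum_norm_le. Qed.

(** It serves for 1 - D D^ddagger and 1 - D^ddagger D, which are computed explicitly on dense
    subspaces. *)
Lemma dense_closed_linear U V (E : set U) (N : set V) (f : {linear U -> V})
    (M : R) : (forall x, nrm (f x) <= M * nrm x) ->
  dense E -> closed N -> (forall x, E x -> N (f x)) -> forall x, N (f x).
Proof.
move=> fM dE cN fE x; apply: (closed_nrmP N).1 => // e e0.
have k0 : 0 < `|M| + 1 :> R by rewrite ltr_wpDl.
have [z Ez xz] := dense_nrmP dE x (divr_gt0 e0 k0).
exists (f z); first exact: fE.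
rewrite -linearB; apply: le_lt_trans (fM _) _; rewrite ltr_pdivlMr// in xz.
apply: le_lt_trans xz; rewrite mulrC ler_wpM2l ?nrm_ge0//.
by rewrite (le_trans (ler_norm _))// lerDl.
Qed.

Lemma nrm_sub_comp U V (f : bounded_op V U) (g : bounded_op U V) :
  exists M : R, forall x, nrm ((idfun \- (f \o g)) x) <= M * nrm x.
Proof.
have [M M0 fM] := bounded_op_nrm f; have [N N0 gN] := bounded_op_nrm g.
exists (1 + M * N) => x /=; apply: le_trans (nrmD _ _) _.
rewrite nrmN mulrDl mul1r lerD2l; apply: le_trans (fM _) _.
by rewrite -mulrA ler_wpM2l.
Qed.

Lemma resolvent_set0P U (T : operator U U) : resolvent_set T 0 <->
  exists Q : bounded_op U U, forall x y, op_graph T (x, y) <-> x = Q y.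
Proof.
by split=> -[Q QP]; exists Q => x y; rewrite -QP op_shiftE scale0r addr0.
Qed.

End BoundedOperators.

(** * Transfer from the operator matrix to the Schur complement *)

Section SchurComplement.
Variables (R : realType) (H1 H2 DS D2 Dm1 Dm2 : hilbertType R[i]).
Variables (iS : embedding DS H1) (i2 : embedding D2 H2).
Variables (j1 : embedding H1 Dm1) (j2 : embedding H2 Dm2).
Variables (A : bounded_op DS Dm1) (B : bounded_op D2 Dm1).
Variables (C : bounded_op DS Dm2) (D : bounded_op D2 Dm2).
Variables (Dd : bounded_op Dm2 D2).

Let A0 := maximal_operator (emb_sum iS i2) (emb_sum j1 j2) (block_op A B C D).
Let S := schur_complement A B C Dd.
Let S0 := maximal_operator iS j1 S.
Let q : {linear Dm2 -> Dm2} := idfun \- (D \o Dd).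

Lemma block_op_lift u : block_op A B C D (u, - Dd (C u)) = (S u, q (C u)).
Proof. by rewrite block_opE /= !linearN. Qed.

Lemma maximal_block_lift u h z : S u = j1 h -> q (C u) = j2 z ->
  op_graph A0 ((iS u, - i2 (Dd (C u))), (h, z)).
Proof.
move=> Su Cu; apply/maximal_operatorE; exists (u, - Dd (C u)).
  by rewrite emb_sumE /= linearN.
by rewrite block_op_lift emb_sumE Su Cu.
Qed.

Lemma maximal_block_resolvent : cancel Dd D -> cancel D Dd ->
  resolvent_set A0 0 -> resolvent_set S0 0.
Proof.
move=> DdK DK /resolvent_set0P[Q QP]; apply/resolvent_set0P.
have q0 v : q v = 0 by rewrite /= DdK subrr.
have lin1 : linear (fun h : H1 => (Q (h, 0)).1).
  move=> a h h'; rewrite (_ : (_, _) = a *: ((h, 0) : hsum H1 H2) + (h', 0)).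
    by rewrite linearP.
  by congr (_, _); rewrite /= scaler0 addr0.
pose Q1 : {linear H1 -> H1} :=
  HB.pack (fun h : H1 => (Q (h, 0)).1) (GRing.isLinear.Build _ _ _ _ _ lin1).
have Q1b : exists M : R[i], forall h, `|Q1 h| <= M * `|h|.
  have [M M0 QM] := bop_bound_ge0 Q; exists M => h.
  apply: le_trans (hsum_norm1 _) _; apply: le_trans (QM _) _.
  rewrite ler_wpM2l//; apply: le_trans (hsum_norm_le _) _.
  by rewrite /= normr0 addr0.
exists (BoundedOp Q1b) => x h; split.
  move=> /maximal_operatorE[u -> Su] /=.
  (* [Q (h, 0)] is the only preimage of (h, 0) under A_0, so it is the lift of u. *)
  have /QP <- // : op_graph A0 ((iS u, - i2 (Dd (C u))), (h, 0)).
  by apply: maximal_block_lift; rewrite // q0 linear0.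
move=> -> /=; have [[u g]] :=
  (maximal_operatorE _ _ _ _ _).1 ((QP (Q (h, 0)) (h, 0)).2 erefl).
rewrite block_opE !emb_sumE /= => -> [Eu Eg] /=.
exists u => //; rewrite -Eu; congr (_ + _).
(* The second row reads C u + D g = 0; apply D^ddagger. *)
have -> : g = - Dd (C u).
  rewrite -[LHS]DK; rewrite linear0 in Eg; move/eqP: Eg.
  by rewrite addrC addr_eq0 => /eqP ->; rewrite linearN.
by rewrite linearN.
Qed.

Lemma maximal_block_semiFredholm (s : seq H2) :
  (forall v, lspan (map j2 s) (q v)) ->
  closed_operator S0 -> semiFredholm_plus A0 -> semiFredholm_plus S0.
Proof.
move=> qs cS0 FA0; have [cA0 _ /finite_dimensionalP[r kerA0]] := FA0.
pose f : {linear DS -> Dm2} := q \o C.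
pose L : set (hsum H1 H2 * hsum H1 H2) :=
  [set p | [/\ op_graph A0 p, op_graph S0 (p.1.1, p.2.1) & p.2.2 = 0]].
have sL : submodule L.
  split=> [|a p p' [Ap Sp p0] [Ap' Sp' p0']].
    by split=> //; exact: op_graph0.
  split; [exact: op_graph_linear|exact: (op_graph_linear a Sp Sp')|].
  by rewrite /= p0 p0' scaler0 addr0.
have cL : closed L.
  apply/closed_pairP => x y xyL; split.
  - apply: (closed_pairP _).1 cA0 _ _ _ => e /xyL[p [[Ap _ _] xp yp]].
    by exists p.
  - apply: (closed_pairP _).1 cS0 _ _ _ => e /xyL[p [[_ Sp _] xp yp]].
    exists (p.1.1, p.2.1); split=> //=.
    + exact: le_lt_trans (hsum_nrm1 (x - p.1)) xp.
    + exact: le_lt_trans (hsum_nrm1 (y - p.2)) yp.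
  - apply: nrm_lt_eps => e /xyL[p [[_ _ p0] _ yp]].
    by apply: le_lt_trans yp; have := hsum_nrm2 (y - p.2); rewrite /= p0 subr0.
pose E := [set h : H1 | exists x, L (x, (h, 0))].
have cE : closed E.
  have cran :=
    closed_ran_restriction FA0 sL cL (fun p => fun '(And3 Ap _ _) => Ap).
  apply/closed_nrmP => h hE; apply: (closed_nrmP _).1 cran (h, 0) _ => e /hE.
  move=> [h' [x xL] hh']; exists (h', 0); first by exists x.
  apply: le_lt_trans (hsum_nrm_le _) _.
  by rewrite /= subrr (@nrm0 R H2) addr0.
have sE : submodule E.
  split=> [|a h h' [x xL] [x' xL']]; first by exists 0; exact: submodule0 sL.
  exists (a *: x + x'); have := submoduleP sL a xL xL'.
  by rewrite (_ : _ + _ = (a *: x + x', (a *: h + h', 0)))//; congr (_, (_, _));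
    rewrite /= scaler0 addr0.
split=> //.
(* [X] is the domain of S_0 seen in D_S. Modulo [lspan t] its elements are killed by q C, and their
   lifts then give pairs in [L]. *)
- pose X := [set u : DS | exists h, S u = j1 h].
  have sX : submodule X.
    split=> [|a u u' [h Su] [h' Su']]; first by exists 0; rewrite !linear0.
    by exists (a *: h + h'); rewrite !linearP Su Su'.
  have [|t [tX tP]] := finite_codim_kernel (f := f) (s := map j2 s) sX.
    by move=> u _; exact: qs.
  (* [sg u] is the value of S_0 at u; the default 0 outside [X] is harmless because [t] lies in
     [X]. *)
  have /choice[sg sgP] u : exists h, X u -> S u = j1 h.
    by have [[h Su]|nX] := pselect (X u); [exists h|exists 0].
  have tran w : lspan t w -> exists2 h, lspan (map sg t) h & S w = j1 h.
    pose Y := [set w | exists2 h, lspan (map sg t) h & S w = j1 h].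
    suff : lspan t `<=` Y by exact.
    apply: lspan_min => [|u tu].
      have sS := submodule_lspan (map sg t).
      split=> [|a u u' [h th Su] [h' th' Su']].
        by exists 0; [exact: submodule0 sS|rewrite !linear0].
      by exists (a *: h + h'); [exact: submoduleP|rewrite !linearP Su Su'].
    by exists (sg u); [exact/lspan_mem/map_f|exact/sgP/tX].
  rewrite (_ : ran S0 = [set h + k | h in E & k in lspan (map sg t)]).
    exact: closed_add_lspan.
  apply/seteqP; split=> [h [x /maximal_operatorE[u _ Su]]|_ [h Eh [k tk <-]]].
    have [|w tw fw] := tP u; first by exists h.
    have [k tk Sw] := tran w tw.
    exists (h - k); last by exists k; rewrite ?subrK.
    have Suw : S (u - w) = j1 (h - k) by rewrite (linearB S) (linearB j1) Su Sw.
    exists (iS (u - w), - i2 (Dd (C (u - w)))); split=> //.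
      by apply: maximal_block_lift; rewrite // linear0.
    by apply/maximal_operatorE; exists (u - w).
  have sranS := submodule_ran S0; apply: (submoduleD sranS).
    by have [x [_ Sx _]] := Eh; exists x.1.
  move: tk; apply: lspan_min => // _ /mapP[u /tX Xu ->].
  by exists (iS u); apply/maximal_operatorE; exists u => //; exact: sgP.
- apply/finite_dimensionalP.
  pose X := [set u : DS | S u = 0].
  have sX : submodule X.
    split=> [|a u u' Su Su']; first exact: linear0.
    by rewrite /X /mkset (linearP S) Su Su' scaler0 addr0.
  have [|t [tX tP]] := finite_codim_kernel (f := f) (s := map j2 s) sX.
    by move=> u _; exact: qs.
  pose p1 : {linear hsum H1 H2 -> H1} := fst.
  (* For u in the kernel of S, the lift of u - w is in ker A_0; its first component and the image of
     w account for the two lists. *)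
  apply: (@lspan_submodule _ _ (map p1 r ++ map iS t)).
    exact: submodule_ker.
  move=> x /maximal_operatorE[u -> Su]; rewrite linear0 in Su.
  have [w tw fw] := tP u Su.
  rewrite -[u](subrK w) linearD; apply: lspan_cat; last first.
    by rewrite -lspan_map; exists w.
  rewrite -lspan_map -kerA0.
  exists (iS (u - w), - i2 (Dd (C (u - w)))) => //.
  apply: maximal_block_lift; last by rewrite linear0.
  have Sw : S w = 0 by apply: (lspan_min sX tX).
  by rewrite linear0 linearB Su Sw subr0.
Qed.

End SchurComplement.

(** * The relation between D and D^ddagger, deduced from D_0 by density *)

Theorem theorem2p7 (R : realType)
  (H1 H2 DS D2 DmS Dm1 Dm2 : hilbertType R[i])
  (* D_S in H_1 in D_{-S} and D_2 in H_2 in D_{-2}, continuously and densely,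
     and D_{-S} in D_{-1}, continuously *)
  (iS : embedding DS H1) (jS : embedding H1 DmS)
  (i2 : embedding D2 H2) (j2 : embedding H2 Dm2)
  (k : embedding DmS Dm1)
  (iS_dense : dense (range iS)) (jS_dense : dense (range jS))
  (i2_dense : dense (range i2)) (j2_dense : dense (range j2))
  (A : bounded_op DS Dm1) (B : bounded_op D2 Dm1) (C : bounded_op DS Dm2)
  (D0 : operator H2 H2)
  (D0_closed : closed_operator D0) (D0_ran : closed (ran D0))
  (D0_dom : dom D0 `<=` range i2) (D0_dense : dense (i2 @^-1` dom D0))
  (D : bounded_op D2 Dm2)
  (D_ext : forall u y, op_graph D0 (i2 u, y) -> D u = j2 y)
  (Dd : bounded_op Dm2 D2)
  (Dd_ext : forall x y,
     op_graph (generalised_inverse D0) (x, y) -> i2 (Dd (j2 x)) = y) :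
  let j1 := emb_comp k jS in
  let A0 : operator (hsum H1 H2) (hsum H1 H2) :=
    maximal_operator (emb_sum iS i2) (emb_sum j1 j2) (block_op A B C D) in
  let S0 : operator H1 H1 :=
    maximal_operator iS j1 (schur_complement A B C Dd) in
  let C0 : operator H1 H2 := maximal_operator iS j2 C in
  (resolvent_set D0 0 -> resolvent_set A0 0 -> resolvent_set S0 0) /\
  (closed_operator S0 ->
   coker D0 = [set 0] \/
     [/\ semiFredholm_minus D0, coker D0 `<=` dom_adjoint C0 &
         dense (iS @^-1` dom C0)] ->
   semiFredholm_plus A0 -> semiFredholm_plus S0).
Proof.
move=> j1 A0 S0 C0; split=> [/resolvent_set0P[Q QP]|].
  have kerD0 x : ker D0 x -> x = 0 by move=> /QP ->; rewrite linear0.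
  (* D_0 is a bijection onto H_2 with inverse [Q], so the splitting y = y + 0 identifies D_0^# with
     [Q]. *)
  have gQ y : op_graph (generalised_inverse D0) (y, Q y).
    apply/generalised_inverseE; exists y, 0; split.
    - by rewrite addr0.
    - by move=> x _; rewrite linear0r.
    - exact/QP.
    - by move=> x /kerD0 ->; rewrite linear0l.
  (* [lspan [::]] is the zero subspace, so this reads D D^ddagger = 1; it is checked on H_2, dense
     in D_{-2}. *)
  have DdK v : lspan [::] ((idfun \- (D \o Dd)) v).
    have [M qM] := nrm_sub_comp D Dd.
    apply: (dense_closed_linear qM j2_dense (@closed_lspan _ _ [::])).
    move=> _ [y _ <-] /=; rewrite (D_ext (Dd (j2 y)) y) ?subrr//.
    by rewrite (Dd_ext _ _ (gQ y)); exact/QP.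
  (* Likewise D^ddagger D = 1, checked on dom D_0, dense in D_2, after applying the injection
     [i2]. *)
  have DK u : lspan [::] ((idfun \- (Dd \o D)) u).
    have [M qM] := nrm_sub_comp Dd D.
    apply: (dense_closed_linear qM D0_dense (@closed_lspan _ _ [::])).
    move=> {}u [y uy] /=; rewrite (D_ext _ _ uy).
    apply/(@emb_inj _ _ _ i2); rewrite linearB (Dd_ext _ _ (gQ y)) linear0.
    by apply/eqP; rewrite subr_eq0; apply/eqP/QP.
  by apply: maximal_block_resolvent => [v|u]; apply/eqP;
    rewrite eq_sym -subr_eq0; apply/eqP; [exact: DdK|exact: DK].
move=> cS0 cokerD0.
have /finite_dimensionalP[s cokerE] : finite_dimensional (coker D0).
  case: cokerD0 => [->|[[_ _]]//].
  by apply/finite_dimensionalP; exists [::].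
apply: (maximal_block_semiFredholm (s := s)) => // v.
have [M qM] := nrm_sub_comp D Dd.
apply: (dense_closed_linear qM j2_dense (@closed_lspan _ _ (map j2 s))).
move=> _ [y _ <-] /=.
(* Split y = a + z along ran D_0 and coker D_0. As D_0 maps D_0^# y to a, the operator 1 - D
   D^ddagger maps y to z. *)
have [x yx] := generalised_inverse_total y D0_closed D0_ran.
have [a [z [yE zD0 xa _]]] := (generalised_inverseE D0 y x).1 yx.
rewrite (D_ext (Dd (j2 y)) a); last by rewrite (Dd_ext _ _ yx).
rewrite -linearB yE addrAC subrr add0r -lspan_map; exists z => //.
by rewrite -cokerE.
Qed.
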